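(* Let $n\ge 1$, let $A:\mathbb{R}\to M_{2n}(\mathbb{R})$ be a continuous (not necessarily periodic) map with $A(t)$ symmetric for all $t$, and let $\gamma$ be the solution of $$\frac{\mathrm{d}\gamma}{\mathrm{d}t}(t)=J_{2n}A(t)\gamma(t),\qquad \gamma(0)\in \mathrm{Sp}(2n,\mathbb{R}).$$ Assume that for all $t\in\mathbb{R}$ and all $\omega\in U$, $A(t)$ is strictly positive definite on $\ker(\omega\cdot\mathrm{Id}-\gamma(t))\subset\mathbb{C}^{2n}$, i.e. $\langle A(t)x,x\rangle>0$ for every nonzero $x$ in this kernel. Then the set $$D=\{t\in\mathbb{R}:\gamma(t)\text{ has a Krein indefinite eigenvalue on }U\}$$ is discrete.
   Context: $U=\{z\in\mathbb{C}:|z|=1\}$. $J_{2n}=\begin{bmatrix}0&\mathrm{Id}_n\\-\mathrm{Id}_n&0\end{bmatrix}$, and $\mathrm{Sp}(2n,\mathbb{R})$ is the group of real $2n\times 2n$ matrices $M$ with $M^TJ_{2n}M=J_{2n}$. $\langle x,y\rangle=\sum_j x_j\bar y_j$ is the standard inner product on $\mathbb{C}^{2n}$. The Krein form on $\mathbb{C}^{2n}$ is $(x,y)_G=\sqrt{-1}\,\langle x,J_{2n}y\rangle=\sqrt{-1}\sum_{k=1}^n(x_k\bar y_{n+k}-x_{n+k}\bar y_k)$, a Hermitian form. For an eigenvalue $\lambda$ of a $2n\times 2n$ matrix $M$, $E_\lambda=E_\lambda(M)=\ker(\lambda\cdot\mathrm{Id}-M)^{2n}\subset\mathbb{C}^{2n}$.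 An eigenvalue $\lambda\in U$ of a symplectic matrix is Krein positive (resp. negative) definite if $(\cdot,\cdot)_G$ is positive (resp. negative) definite on $E_\lambda$, and Krein indefinite if $(\cdot,\cdot)_G$ is indefinite on $E_\lambda$. *)

(* Defs.v *)
From HB Require Import structures.
From mathcomp Require Import all_boot all_order all_algebra.
From mathcomp Require Import complex.
From mathcomp Require Import all_classical all_reals all_analysis.

Set Implicit Arguments.
Unset Strict Implicit.
Unset Printing Implicit Defensive.

Import Order.TTheory GRing.Theory Num.Theory.
Import numFieldNormedType.Exports.

Local Open Scope classical_set_scope.
Local Open Scope ring_scope.

(* Matrices act on column vectors; the dimension 2n is written n + n, so that
   the block decomposition of J is definitional. *)

Definition Jmx (K : pzRingType) (n : nat) : 'M[K]_(n + n) :=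
  block_mx 0 1%:M (- 1%:M) 0.

Definition symplectic (K : pzRingType) (n : nat) (M : 'M[K]_(n + n)) : Prop :=
  M^T *m Jmx K n *m M = Jmx K n.

Definition complexify (R : realType) (m : nat) (M : 'M[R]_m) : 'M[R[i]]_m :=
  map_mx (real_complex R) M.

(* Linear in the first argument, antilinear in the second. *)
Definition cdot (R : realType) (m : nat) (x y : 'cV[R[i]]_m) : R[i] :=
  \sum_(j < m) x j 0 * (y j 0)^*.

Definition krein (R : realType) (n : nat) (x y : 'cV[R[i]]_(n + n)) : R[i] :=
  'i * cdot x (Jmx R[i] n *m y).

Definition unit_circle (R : realType) : set R[i] := [set z | `|z| = 1].

Definition cker (R : realType) (m : nat) (M : 'M[R[i]]_m) : set 'cV[R[i]]_m :=
  [set x | M *m x = 0].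

Definition gen_eigenspace (R : realType) (m : nat) (M : 'M[R[i]]_m)
    (lambda : R[i]) : set 'cV[R[i]]_m :=
  cker ((lambda%:M - M) ^+ m).

(* In R[i], [0 < z] and [z < 0] entail that z is real; krein x x always is. *)
Definition krein_indefinite_on (R : realType) (n : nat)
    (E : set 'cV[R[i]]_(n + n)) : Prop :=
  (exists2 x, E x & 0 < krein x x) /\ (exists2 y, E y & krein y y < 0).

(* [eigenvalue] is defined through row eigenvectors; a square matrix has the
   same eigenvalues on rows and on columns. *)
Definition krein_indefinite_eigenvalue (R : realType) (n : nat)
    (M : 'M[R]_(n + n)) (lambda : R[i]) : Prop :=
  [/\ eigenvalue (complexify M) lambda, unit_circle lambda &
      krein_indefinite_on (gen_eigenspace (complexify M) lambda)].

(* Discreteness in the subspace topology. *)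
Definition discrete_subset (T : topologicalType) (D : set T) : Prop :=
  D `<=` isolated D.

(* Main.v *)
(** If a point [t0] of [D] were not isolated, then along an ultrafilter of times
    [t -> t0] in [D] there would be null eigenvectors [x_t -> x0 <> 0] of
    [gamma t] with eigenvalues tending to some [l0] on the circle: a Jordan chain
    or an indefinite eigenspace always contains a null eigenvector. With
    [tau = t - t0] and [N = i (l0^* M - l0 M^-1)], [M = gamma t0], which is
    self-adjoint for the Krein form [B], these satisfy [N x = c x + tau b] with
    [c, tau -> 0] real and [B b0 x0] a positive multiple of [<A x0, x0>], where
    [b0 = lim b].  So it is enough to show [B b0 x0 = 0].

    Let [m] be least such that [c^m / tau] converges, say to [r]; then [m >= 1].
    Dividing [N^(m-1) x] and [N^m x] by suitable scalars and passing to the limit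
    gives [x0 = N^(m-1) z] and [r x0 + N^(m-1) b0 = N^m w]. A matrix [H] with
    [N H - H N = N] on the generalized kernel of [N] yields, from [B x x = 0], the
    limit identity [B (H x0) b0 - B (H b0) x0 = B x0 b0], whose left-hand side is
    also [- (m - 1) B x0 b0] by commuting [H] with powers of [N]. *)
Require Import Defs.
From mathcomp Require Import all_boot all_order all_algebra.
From mathcomp Require Import complex ring.
From mathcomp Require Import all_classical all_reals all_analysis.

Import Order.TTheory GRing.Theory Num.Theory.
Import numFieldNormedType.Exports.

Local Open Scope classical_set_scope.
Local Open Scope ring_scope.

Set Implicit Arguments.
Unset Strict Implicit.
Unset Printing Implicit Defensive.

(** * Commutators and the grading operator *)

(** Every eigenvalue vanishes, so the characteristic polynomial is a pure power of ['X]; the trace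
    is minus its subleading coefficient. *)
Lemma mxtrace_nilpotent (F : closedFieldType) (n k : nat) (A : 'M[F]_n.+1) :
  A ^+ k = 0 -> \tr A = 0.
Proof.
move=> Ak0; have [r char_r] := closed_field_poly_normal (char_poly A).
rewrite (monicP (char_poly_monic A)) scale1r in char_r.
have r0 z : z \in r -> z = 0.
  move=> zr.
  have : eigenvalue A z by rewrite eigenvalue_root_char char_r root_prod_XsubC.
  case/eigenvalueP => v Av v0.
  have : v *m A ^+ k = z ^+ k *: v.
    elim: k {Ak0} => [|k IHk]; first by rewrite !expr0 mulmx1 scale1r.
    by rewrite exprS -mulmxE mulmxA Av -scalemxAl IHk scalerA exprS.
  rewrite Ak0 mulmx0 => /esym/eqP; rewrite scaler_eq0 (negbTE v0) orbF.
  by rewrite expf_eq0 => /andP[_ /eqP].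
have charX : char_poly A = 'X^(size r).
  rewrite char_r big_seq (eq_bigr (fun _ => 'X)) => [|z /r0 ->].
    by rewrite -big_seq big_const_seq count_predT iter_mulr_1.
  by rewrite polyC0 subr0.
have size_r : size r = n.+1.
  by have := size_char_poly A; rewrite charX size_polyXn => -[].
apply: oppr_inj; rewrite oppr0 -char_poly_trace // charX size_r coefXn.
by rewrite eqn_leq ltnn andbF.
Qed.

Lemma mxtrace_vec_mx (F : comNzRingType) (m n : nat) (A : 'M[F]_(m, n))
    (v : 'rV_(m * n)) :
  \tr (A *m (vec_mx v)^T) = (mxvec A *m v^T) 0 0.
Proof.
rewrite mxE (reindex _ (curry_mxvec_bij _ _)) /=.
rewrite [RHS](eq_bigr (fun p => A p.1 p.2 * (vec_mx v) p.1 p.2)); last first.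
  by move=> [i j] _ /=; rewrite mxvecE !mxE.
rewrite -(pair_bigA _ (fun i j => A i j * (vec_mx v) i j)) /=.
by apply: eq_bigr => i _; rewrite mxE; apply: eq_bigr => j _; rewrite [_^T _ _]mxE.
Qed.

Lemma mxtrace_mul_eq0 (F : comNzRingType) (n : nat) (Z : 'M[F]_n) :
  (forall X, \tr (X *m Z) = 0) -> Z = 0.
Proof.
move=> trZ; apply/matrixP => i j; rewrite [RHS]mxE -(trZ (delta_mx j i)).
rewrite /mxtrace (bigD1 j) //= big1 => [|k kj].
  rewrite mxE (bigD1 i) //= big1 => [|l li]; rewrite !mxE ?eqxx ?(negbTE li).
    by rewrite mul1r !addr0.
  by rewrite andbF mul0r.
by rewrite mxE big1 // => l _; rewrite mxE (negbTE kj) mul0r.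
Qed.

(* The image of [X |-> N X - X N] is the orthogonal of the commutant of N for
   the trace pairing. *)
Lemma commutator_solvable (F : fieldType) (n : nat) (N M : 'M[F]_n) :
    (forall Y, Y *m N = N *m Y -> \tr (M *m Y) = 0) ->
  exists X, N *m X - X *m N = M.
Proof.
move=> trM; pose f := (mulmx N \- mulmxr N)%R : 'M[F]_n -> 'M[F]_n.
have fE X : mxvec X *m lin_mx f = mxvec (f X) by rewrite mul_vec_lin.
suff: (mxvec M <= lin_mx f)%MS.
  case/submxP => v vM; exists (vec_mx v).
  by apply: (can_inj mxvecK); rewrite vM -[v in RHS]vec_mxK fE.
(* Membership in a row space is tested on the columns of [cokermx]. Such a column, reshaped and
   transposed, is a matrix whose trace pairing kills every commutator with [N]; it therefore
   commutes with [N], and [trM] applies. *)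
rewrite submxE; apply/eqP/rowP => j; rewrite [RHS]mxE.
pose v : 'rV_(n * n) := (col j (cokermx (lin_mx f)))^T.
have vE w : (w *m cokermx (lin_mx f)) 0 j = (w *m v^T) 0 0.
  by rewrite trmxK !mxE; apply: eq_bigr => k _; rewrite [col _ _ _ _]mxE.
rewrite vE -mxtrace_vec_mx; apply: trM; apply/eqP; rewrite -subr_eq0.
apply/eqP/mxtrace_mul_eq0 => X.
have -> : \tr (X *m ((vec_mx v)^T *m N - N *m (vec_mx v)^T)) =
    \tr (f X *m (vec_mx v)^T).
  rewrite mulmxBr mulmxBl !raddfB /= mulmxA mxtrace_mulC.
  by rewrite !mulmxA.
by rewrite mxtrace_vec_mx -fE -vE -mulmxA mulmx_coker mulmx0 mxE.
Qed.

(** [P] projects onto the generalized kernel of [N]. It is a polynomial in [N], given by a Bezout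
    relation between a power of ['X] and the part of the characteristic polynomial prime to ['X].
    The exponent [k.+1] stays positive even when [N] is invertible. *)
Lemma fitting_projection (F : fieldType) (n : nat) (N : 'M[F]_n.+1) :
  exists (k : nat) (P Q : 'M[F]_n.+1), [/\ P * N ^+ k.+1 = 0,
    1 - P = Q * N ^+ k.+1 & GRing.comm P N].
Proof.
have [k [q]] := multiplicity_XsubC (char_poly N) 0.
rewrite -size_poly_eq0 size_char_poly /= subr0 => q0 char_q.
have /Bezout_coprimepP[[u v] /= /eqpP[[a b] /= /andP[a0 b0] Euv]] :
    coprimep ('X^(k.+1) : {poly F}) q.
  apply: coprimep_expl; rewrite coprimep_sym -['X]subr0 -polyC0.
  by rewrite coprimep_XsubC.
have {Euv} [u' [v' Euv]] : exists u' v' : {poly F}, u' * 'X^(k.+1) + v' * q = 1.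
  exists ((a / b) *: u), ((a / b) *: v).
  rewrite -!scalerAl -scalerDr mulrC -scalerA Euv scalerA mulVf //.
  by rewrite scale1r.
exists k, (horner_mx N (v' * q)), (horner_mx N u').
have hX : horner_mx N 'X^(k.+1) = N ^+ k.+1 by rewrite rmorphXn /= horner_mx_X.
split.
- rewrite -hX -(rmorphM (horner_mx N)).
  have -> : v' * q * 'X^(k.+1) = v' * 'X * char_poly N.
    by rewrite char_q exprS; ring.
  by rewrite rmorphM /= Cayley_Hamilton mulr0.
- by rewrite -hX -rmorphM /= -(rmorph1 (horner_mx N)) -rmorphB -Euv addrK.
- by apply/comm_horner_mx/esym.
Qed.

(* [H] is a grading operator on the generalized kernel of [N]: there
   [[N, H] = N]. *)
Lemma grading_operator (F : closedFieldType) (n : nat) (N : 'M[F]_n.+1) :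
  exists (k : nat) (P Q H : 'M[F]_n.+1), [/\ P * N ^+ k.+1 = 0,
    1 - P = Q * N ^+ k.+1, GRing.comm P N & N * H - H * N = N * P].
Proof.
have [k [P [Q [PN QN cPN]]]] := fitting_projection N.
suff [H NH] : exists H, N * H - H * N = N * P by exists k, P, Q, H.
(* For [Y] commuting with [N], the product [N * P * Y] is nilpotent, because its power [k.+1]
   contains the factor [P * N ^+ k.+1]. *)
apply: commutator_solvable => Y cYN; apply: (@mxtrace_nilpotent _ _ k.+1).
have cN : GRing.comm N (P * Y) by apply: commrM; apply: commr_sym.
rewrite mulmxE -mulrA exprMn_comm // [(P * Y) ^+ _]exprS !mulrA.
by rewrite -(commrX k.+1 cPN) PN !mul0r.
Qed.

(** * Entrywise limits and sesquilinear forms *)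
Section MatrixLimits.
Variables (C : numClosedFieldType) (T : Type) (F : set_system T).
Context {FF : Filter F}.

(** Convergence is taken entry by entry, so that each rule below reduces to its scalar
    counterpart. *)
Definition mx_cvg (m n : nat) (f : T -> 'M[C]_(m, n)) (l : 'M[C]_(m, n)) : Prop :=
  forall i j, f t i j @[t --> F] --> l i j.

Lemma mx_cvg_cst m n (l : 'M[C]_(m, n)) : mx_cvg (fun=> l) l.
Proof. by move=> i j; apply: cvg_cst. Qed.

Lemma mx_cvgD m n (f g : T -> 'M[C]_(m, n)) a b :
  mx_cvg f a -> mx_cvg g b -> mx_cvg (fun t => f t + g t) (a + b).
Proof.
move=> fa gb i j; rewrite mxE; under eq_cvg do rewrite mxE.
exact: cvgD (fa i j) (gb i j).
Qed.

Lemma mx_cvgN m n (f : T -> 'M[C]_(m, n)) a :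
  mx_cvg f a -> mx_cvg (fun t => - f t) (- a).
Proof.
move=> fa i j; rewrite mxE; under eq_cvg do rewrite mxE.
exact: cvgN (fa i j).
Qed.

Lemma mx_cvgB m n (f g : T -> 'M[C]_(m, n)) a b :
  mx_cvg f a -> mx_cvg g b -> mx_cvg (fun t => f t - g t) (a - b).
Proof. by move=> fa gb; apply: mx_cvgD fa (mx_cvgN gb). Qed.

Lemma mx_cvgZ m n (k : T -> C) (f : T -> 'M[C]_(m, n)) (c : C) a :
  k t @[t --> F] --> c -> mx_cvg f a -> mx_cvg (fun t => k t *: f t) (c *: a).
Proof.
move=> kc fa i j; rewrite mxE; under eq_cvg do rewrite mxE.
exact: cvgM kc (fa i j).
Qed.

Lemma mx_cvgM m n p (f : T -> 'M[C]_(m, n)) (g : T -> 'M[C]_(n, p)) a b :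
  mx_cvg f a -> mx_cvg g b -> mx_cvg (fun t => f t *m g t) (a *m b).
Proof.
move=> fa gb i j; rewrite mxE; under eq_cvg do rewrite mxE.
apply: cvg_big => [|k _]; first exact: add_continuous.
exact: cvgM (fa i k) (gb k j).
Qed.

Lemma mx_cvg_tr m n (f : T -> 'M[C]_(m, n)) a :
  mx_cvg f a -> mx_cvg (fun t => (f t)^T) a^T.
Proof.
move=> fa i j; rewrite mxE; under eq_cvg do rewrite mxE.
exact: fa.
Qed.

Lemma cvg_conjC (f : T -> C) (a : C) :
  f t @[t --> F] --> a -> (f t)^* @[t --> F] --> a^*.
Proof.
move=> /cvgrPdist_lt fa; apply/cvgrPdist_lt => e /fa.
by apply: filterS => t; rewrite -rmorphB norm_conjC.
Qed.

Lemma mx_cvg_conjC m n (f : T -> 'M[C]_(m, n)) a :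
  mx_cvg f a -> mx_cvg (fun t => map_mx Num.conj (f t)) (map_mx Num.conj a).
Proof.
move=> fa i j; rewrite mxE; under eq_cvg do rewrite mxE.
exact: cvg_conjC.
Qed.

End MatrixLimits.
Arguments mx_cvg_cst {C T F FF m n} l.

Lemma mx_cvg_unique (C : numClosedFieldType) (T : Type) (F : set_system T)
    {FF : ProperFilter F} m n (f : T -> 'M[C]_(m, n)) a b :
  mx_cvg F f a -> mx_cvg F f b -> a = b.
Proof.
move=> fa fb; apply/matrixP => i j.
exact: (@cvg_unique C (@norm_hausdorff C C) _ _ _ _ (fa i j) (fb i j)).
Qed.

(** The image of [A] is the solution set of linear equations, which pass to the limit. Transposes
    appear because [submx] compares row spaces. *)
Lemma mulmx_image_closed (C : numClosedFieldType) (T : Type) (F : set_system T)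
    {FF : ProperFilter F} m n (A : 'M[C]_(m, n)) (f : T -> 'cV[C]_m) l :
    (\forall t \near F, exists y, f t = A *m y) -> mx_cvg F f l ->
  exists y, l = A *m y.
Proof.
move=> fA fl.
have: (l^T <= A^T)%MS.
  rewrite submxE; apply/eqP.
  have lim : mx_cvg F (fun t => (f t)^T *m cokermx A^T) (l^T *m cokermx A^T).
    exact: mx_cvgM (mx_cvg_tr fl) (mx_cvg_cst _).
  apply: mx_cvg_unique lim _ => i j.
  rewrite [X in _ --> X]mxE.
  apply: (@cvg_trans _ ((fun=> 0 : C) @ F)); last exact: cvg_cst.
  apply: near_eq_cvg; apply: filterS fA => t [y ->].
  by rewrite trmx_mul -mulmxA mulmx_coker mulmx0 mxE.
case/submxP => y ly; exists y^T.
by rewrite -[LHS]trmxK ly trmx_mul trmxK.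
Qed.

Section HermitianForm.
Variables (C : numClosedFieldType) (n : nat) (S : 'M[C]_n).

Definition sform (x y : 'cV[C]_n) : C :=
  (x^T *m S *m map_mx Num.conj y) 0 0.

Lemma sformDl x y z : sform (x + y) z = sform x z + sform y z.
Proof. by rewrite /sform raddfD /= !mulmxDl mxE. Qed.

Lemma sformDr x y z : sform z (x + y) = sform z x + sform z y.
Proof. by rewrite /sform map_mxD !mulmxDr mxE. Qed.

Lemma sformZl a x y : sform (a *: x) y = a * sform x y.
Proof. by rewrite /sform linearZ /= -!scalemxAl mxE. Qed.

Lemma sformZr a x y : sform x (a *: y) = a^* * sform x y.
Proof. by rewrite /sform map_mxZ -!scalemxAr mxE. Qed.

Lemma sformBl x y z : sform (x - y) z = sform x z - sform y z.
Proof. by rewrite -scaleN1r sformDl sformZl mulN1r. Qed.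

Lemma sformBr x y z : sform z (x - y) = sform z x - sform z y.
Proof. by rewrite -scaleN1r sformDr sformZr rmorphN1 mulN1r. Qed.

Lemma sform0l y : sform 0 y = 0.
Proof. by rewrite -(scale0r 0) sformZl mul0r. Qed.

Lemma sform0r x : sform x 0 = 0.
Proof. by rewrite -(scale0r 0) sformZr rmorph0 mul0r. Qed.

Lemma cvg_sform (T : Type) (F : set_system T) {FF : Filter F}
    (f g : T -> 'cV[C]_n) a b :
  mx_cvg F f a -> mx_cvg F g b ->
  sform (f t) (g t) @[t --> F] --> sform a b.
Proof.
move=> fa gb; apply: (mx_cvgM _ (mx_cvg_conjC gb)).
exact: mx_cvgM (mx_cvg_tr fa) (mx_cvg_cst S).
Qed.

End HermitianForm.

(** Bolzano-Weierstrass along [U], kept as a hypothesis so that the limit arguments make sense over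
    any [numClosedFieldType]; ultrafilters satisfy it over [R[i]]. *)
Definition bounded_cvg (C : numFieldType) (T : Type) (U : set_system T) : Prop :=
  forall (f : T -> C) (M : C), U [set t | `|f t| <= M] ->
    exists l : C, f t @[t --> U] --> l.

(** Without a limit, no bound on [f] holds on a set of [U]; the ultrafilter then contains every set
    where [f] exceeds a given positive bound. *)
Lemma ultra_cvg_or_inv_cvg0 (C : numFieldType) (T : Type) (U : set_system T)
    {UU : UltraFilter U} (f : T -> C) :
    bounded_cvg C U ->
  (exists l : C, f t @[t --> U] --> l) \/
  (\forall t \near U, f t != 0) /\ (f t)^-1 @[t --> U] --> (0 : C).
Proof.
move=> bU; have [fl|nfl] := EM (exists l : C, f t @[t --> U] --> l); first by left.
have Uf e : 0 < e -> U [set t | e < `|f t|].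
  move=> e0; have [Ufe|] := in_ultra_setVsetC [set t | `|f t| <= e] UU.
    by case: nfl; apply: bU Ufe.
  apply: filterS => t /= /negP; rewrite -real_ltNge ?normr_real //.
  exact: gtr0_real.
right; split.
  by apply: filterS (Uf 1 ltr01) => t; rewrite -normr_gt0; apply: lt_trans.
apply/cvgrPdist_lt => e e0.
have := Uf e^-1; rewrite invr_gt0 => /(_ e0); apply: filterS => t /= ft.
rewrite sub0r normrN normfV invf_plt // posrE.
by apply: lt_trans ft; rewrite invr_gt0.
Qed.

(** * Null limits for a self-adjoint matrix *)

Section SelfAdjointLimit.
Variables (C : numClosedFieldType) (n : nat) (S N : 'M[C]_n.+1).
Local Notation B := (sform S).
Hypothesis N_sa : forall x y, B (N *m x) y = B x (N *m y).

Lemma selfadjoint_pow j x y : B (N ^+ j *m x) y = B x (N ^+ j *m y).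
Proof.
elim: j x y => [|j IHj] x y; first by rewrite !mul1mx.
by rewrite [in LHS]exprS exprSr -mulmxE -!mulmxA N_sa IHj.
Qed.

Lemma grading_pow (P H : 'M[C]_n.+1) j :
    GRing.comm P N -> N * H - H * N = N * P ->
  N ^+ j * H = H * N ^+ j + (P * N ^+ j) *+ j.
Proof.
move=> cPN NH; have {}NH : N * H = H * N + P * N.
  by rewrite cPN -NH addrC subrK.
elim: j => [|j IHj]; first by rewrite !expr0 mulr1 mul1r addr0.
rewrite exprS -mulrA IHj mulrDr mulrA NH mulrnAr mulrA -cPN mulrDl -!mulrA.
by rewrite -exprS -addrA -mulrS.
Qed.

(** Powers of [N] are moved across [B] by self-adjointness and past [H] by [grading_pow]. Both terms
    on the left produce the same multiple of [r], which cancels; what is left comes from the [p]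
    commutations in [H *m x0]. *)
Lemma grading_virial (P H : 'M[C]_n.+1) (p : nat) (r : C) (x0 b0 z w : 'cV_n.+1) :
    GRing.comm P N -> N * H - H * N = N * P ->
    N *m x0 = 0 -> P *m x0 = x0 -> x0 = N ^+ p *m z ->
    r *: x0 + N ^+ p *m b0 = N ^+ p.+1 *m w -> r^* = r ->
  B (H *m x0) b0 - B (H *m b0) x0 = - p%:R * B x0 b0.
Proof.
move=> cPN NH Nx0 Px0 x0E b0E r_real.
have powH j v : N ^+ j *m (H *m v) =
    H *m (N ^+ j *m v) + j%:R *: (P *m (N ^+ j *m v)).
  rewrite mulmxA mulmxE (grading_pow j cPN NH) mulmxDl -scaler_nat.
  by rewrite -scalemxAl -mulmxE -!mulmxA.
have powP j v : N ^+ j *m (P *m v) = P *m (N ^+ j *m v).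
  by rewrite !mulmxA mulmxE (commrX j cPN).
have Nz : N ^+ p.+1 *m z = 0 by rewrite exprS -mulmxE -mulmxA -x0E.
have {}b0E : N ^+ p *m b0 = N ^+ p.+1 *m w - r *: x0.
  by rewrite -b0E addrAC subrr add0r.
have Bzx0 : B z x0 = B x0 z by rewrite [in LHS]x0E [in RHS]x0E selfadjoint_pow.
have Bx0b0 : B x0 b0 = - (r * B x0 z).
  rewrite [in LHS]x0E selfadjoint_pow b0E sformBr -selfadjoint_pow Nz sform0l.
  by rewrite sub0r sformZr r_real Bzx0.
have BHx0 : B (H *m x0) b0 = - (r * (B (H *m x0) z + p%:R * B x0 z))
    - p%:R * B x0 b0.
  have -> : H *m x0 = N ^+ p *m (H *m z) - p%:R *: x0.
    by rewrite powH -x0E Px0 addrK.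
  rewrite sformBl sformZl selfadjoint_pow b0E sformBr -selfadjoint_pow powH Nz.
  rewrite !mulmx0 scaler0 addr0 sform0l sub0r sformZr r_real.
  rewrite [in B (H *m z) x0]x0E -selfadjoint_pow sformBl sformZl.
  by rewrite subrK.
have BHb0 : B (H *m b0) x0 = - (r * (B (H *m x0) z + p%:R * B x0 z)).
  rewrite [in LHS]x0E -selfadjoint_pow powH b0E.
  have -> : H *m (N ^+ p.+1 *m w - r *: x0) + p%:R *: (P *m (N ^+ p.+1 *m w - r *: x0))
      = N ^+ p.+1 *m (H *m w - P *m w) - r *: (H *m x0 + p%:R *: x0).
    rewrite !mulmxBr powH powP -!scalemxAr Px0 scalerBr scalerDr !scalerA.
    rewrite -natr1 scalerDl scale1r (addrA (H *m _)) addrK.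
    by rewrite [r * _]mulrC opprD addrACA.
  by rewrite sformBl selfadjoint_pow Nz sform0r sub0r !(sformZl, sformDl).
by rewrite BHx0 BHb0; ring.
Qed.

Variables (T : Type) (U : set_system T).
Context {UU : UltraFilter U}.
Hypothesis bU : bounded_cvg C U.
Hypothesis B_herm : forall x y, B y x = (B x y)^*.
Variables (x b : T -> 'cV[C]_n.+1) (x0 b0 : 'cV[C]_n.+1) (c tau : T -> C).
Hypothesis Nx : forall t, N *m x t = c t *: x t + tau t *: b t.
Hypothesis null_x : forall t, B (x t) (x t) = 0.
Hypotheses (c_real : forall t, (c t)^* = c t) (tau_real : forall t, (tau t)^* = tau t).
Hypothesis tau_neq0 : forall t, tau t != 0.
Hypotheses (x_cvg : mx_cvg U x x0) (b_cvg : mx_cvg U b b0).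
Hypotheses (c_cvg : c t @[t --> U] --> (0 : C)) (tau_cvg : tau t @[t --> U] --> (0 : C)).
Hypothesis x0_neq0 : x0 != 0.

Let UP : ProperFilter U := ultra_proper.

(** The coefficient of [tau t] when [N ^+ j *m x t] is expanded by repeated use of [Nx]. It is zero
    at index 0 and tends to [N ^+ j *m b0] at index [j.+1]. *)
Fixpoint pow_remainder (j : nat) (t : T) : 'cV[C]_n.+1 :=
  if j is i.+1 then c t ^+ i *: b t + N *m pow_remainder i t else 0.

Lemma pow_remainderE j t :
  N ^+ j *m x t = c t ^+ j *: x t + tau t *: pow_remainder j t.
Proof.
elim: j => [|j IHj]; first by rewrite !expr0 mul1mx scale1r scaler0 addr0.
rewrite exprS -mulmxE -mulmxA IHj mulmxDr -!scalemxAr Nx !scalerDr !scalerA.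
by rewrite -exprSr [c t ^+ j * _]mulrC addrA.
Qed.

Lemma exp_cvg0 j : c t ^+ j.+1 @[t --> U] --> (0 : C).
Proof.
elim: j => [|j IHj]; first by under eq_cvg do rewrite expr1.
rewrite -(mul0r 0); under eq_cvg do rewrite exprS.
exact: cvgM c_cvg IHj.
Qed.

Lemma pow_remainder_cvg j : mx_cvg U (pow_remainder j.+1) (N ^+ j *m b0).
Proof.
elim: j => [|j IHj].
  rewrite expr0 mul1mx => i k; under eq_cvg do
    rewrite /= expr0 scale1r mulmx0 addr0.
  exact: b_cvg.
have -> : N ^+ j.+1 *m b0 = 0 *: b0 + N *m (N ^+ j *m b0).
  by rewrite scale0r add0r exprS -mulmxE mulmxA.
exact: mx_cvgD (mx_cvgZ (exp_cvg0 j) b_cvg) (mx_cvgM (mx_cvg_cst N) IHj).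
Qed.

Lemma mulmx_limit_eq0 : N *m x0 = 0.
Proof.
apply: (mx_cvg_unique (mx_cvgM (mx_cvg_cst N) x_cvg)).
rewrite -[X in mx_cvg _ _ X](addr0 0) -{1}(scale0r x0) -(scale0r b0) => i j.
under eq_cvg do rewrite Nx.
exact: (mx_cvgD (mx_cvgZ c_cvg x_cvg) (mx_cvgZ tau_cvg b_cvg)).
Qed.

Let g m t := c t ^+ m / tau t.

(** Applying [P] to the expansion of [N ^+ k.+1 *m x t] kills the left-hand side. In a coordinate
    where [x0] is nonzero, this expresses the ratio as a quotient of two convergent quantities. *)
Lemma ratio_cvg_exists (P : 'M[C]_n.+1) k :
    P * N ^+ k.+1 = 0 -> P *m x0 = x0 ->
  exists l : C, g k.+1 t @[t --> U] --> l.
Proof.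
move=> PN Px0.
have [i x0i] : exists i, x0 i 0 != 0.
  apply/existsP; rewrite -[[exists _, _]]negbK negb_exists.
  apply: contra x0_neq0 => /forallP x00; apply/eqP/colP => i.
  by rewrite mxE; apply/eqP; rewrite -[_ == _]negbK x00.
pose y t := (P *m x t) i 0; pose s t := (P *m pow_remainder k.+1 t) i 0.
have y_cvg : y t @[t --> U] --> x0 i 0.
  have : mx_cvg U (fun t => P *m x t) (P *m x0).
    exact: mx_cvgM (mx_cvg_cst P) x_cvg.
  by move=> /(_ i 0); rewrite Px0.
have s_cvg : s t @[t --> U] --> (P *m (N ^+ k *m b0)) i 0.
  have : mx_cvg U (fun t => P *m pow_remainder k.+1 t) (P *m (N ^+ k *m b0)).
    exact: mx_cvgM (mx_cvg_cst P) (@pow_remainder_cvg k).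
  exact.
exists (- ((P *m (N ^+ k *m b0)) i 0 * (x0 i 0)^-1)).
apply: (@cvg_trans _ ((fun t => - (s t * (y t)^-1)) @ U)); last first.
  exact: cvgN (cvgM s_cvg (cvgV x0i y_cvg)).
have ynz : \forall t \near U, y t != 0 by exact: cvgr_neq0 y_cvg x0i.
apply: near_eq_cvg.
apply: filterS ynz => t yt0; apply: (mulIf yt0); rewrite mulNr divfK //.
have := congr1 (mulmx P) (pow_remainderE k.+1 t).
rewrite mulmxA mulmxE PN mul0mx mulmxDr -!scalemxAr => /colP/(_ i).
rewrite [LHS]mxE [RHS]mxE [X in X + _]mxE [X in _ + X]mxE -/(y t) -/(s t).
move=> /esym/eqP; rewrite addr_eq0 => /eqP cy.
by rewrite mulrAC cy mulNr mulrAC divff // mul1r.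
Qed.

Lemma selfadjoint_null_limit : B b0 x0 = 0.
Proof.
have [k [P [Q [H [PN QN cPN NH]]]]] := grading_operator N.
have Nx0 := mulmx_limit_eq0.
have Px0 : P *m x0 = x0.
  apply/eqP; rewrite -subr_eq0 -opprB oppr_eq0 -{1}(mul1mx x0) -mulmxBl QN.
  by rewrite exprSr -mulmxE -!mulmxA Nx0 !mulmx0.
have [l_K gK_cvg] := ratio_cvg_exists PN Px0.
(* The ratio of index 0 is the inverse of [tau], which tends to 0; hence the least convergent index
   has the form [p.+1]. *)
have ng0 : ~ exists l : C, g 0 t @[t --> U] --> l.
  case=> l gl; have lim1 : g 0 t * tau t @[t --> U] --> (1 : C).
    by under eq_cvg do rewrite /g expr0 divfK //; apply: cvg_cst.
  have : (1 : C) = l * 0.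
    exact: (@cvg_unique C (@norm_hausdorff C C) _ _ _ _ lim1 (cvgM gl tau_cvg)).
  by rewrite mulr0; apply/eqP/oner_neq0.
have ex_m : exists m, `[< exists l : C, g m t @[t --> U] --> l >].
  by exists k.+1; apply/asboolP; exists l_K.
have [[|p] /asboolP g_cvg g_min] := ex_minnP ex_m; first by case: ng0.
have {g_cvg} [r g_cvg] := g_cvg.
have [[l gl]|[g_neq0 gV_cvg]] := ultra_cvg_or_inv_cvg0 (g p) bU.
  suff: (p < p)%N by rewrite ltnn.
  by apply: g_min; apply/asboolP; exists l.
have r_real : r^* = r.
  have g_conj : (g p.+1 t)^* @[t --> U] --> r.
    under eq_cvg do rewrite /g fmorph_div rmorphXn /= c_real tau_real.
    exact: g_cvg.
  exact: (@cvg_unique C (@norm_hausdorff C C) _ _ _ _ (cvg_conjC g_cvg) g_conj).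
have gE m t : N ^+ m *m ((tau t)^-1 *: x t) = g m t *: x t + pow_remainder m t.
  rewrite -scalemxAr pow_remainderE scalerDr !scalerA mulVf // scale1r.
  by rewrite mulrC.
(* Divide [gE p] by [g p t], whose inverse tends to 0 by minimality of [p.+1]. For [p = 0] the
   remainder is already zero. *)
have [z x0E] : exists z, x0 = N ^+ p *m z.
  apply: (@mulmx_image_closed _ _ U _ _ _ _
    (fun t => x t + (g p t)^-1 *: pow_remainder p t)).
    apply: filterS g_neq0 => t gt0.
    exists ((g p t)^-1 *: ((tau t)^-1 *: x t)).
    by rewrite -scalemxAr gE scalerDr scalerA mulVf // scale1r.
  rewrite -[x0]addr0; apply: mx_cvgD x_cvg _.
  case: (p) gV_cvg => [|q] gV_cvg i j.
    by rewrite mxE; under eq_cvg do rewrite scaler0 mxE; apply: cvg_cst.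
  rewrite -(scale0r (N ^+ q *m b0)).
  exact: mx_cvgZ gV_cvg (@pow_remainder_cvg q) i j.
have [w b0E] : exists w, r *: x0 + N ^+ p *m b0 = N ^+ p.+1 *m w.
  apply: (@mulmx_image_closed _ _ U _ _ _ _
    (fun t => g p.+1 t *: x t + pow_remainder p.+1 t)).
    by apply: nearW => t; exists ((tau t)^-1 *: x t); rewrite gE.
  exact: mx_cvgD (mx_cvgZ g_cvg x_cvg) (@pow_remainder_cvg p).
(* Evaluate [B (N *m P *m x t) (x t)] twice. With [N * P = N * H - H * N] the terms in [c] cancel,
   [c] being real; with [P = 1 - Q * N ^+ k.+1] the term in [c] vanishes by [null_x]. Then divide by
   [tau t]. *)
have virial t : B (H *m x t) (b t) - B (H *m b t) (x t) =
    B (x t) (b t) - B (Q *m (g k.+1 t *: x t + pow_remainder k.+1 t)) (N *m x t).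
  apply: (mulfI (tau_neq0 t)).
  have -> : tau t * (B (H *m x t) (b t) - B (H *m b t) (x t)) =
      B (N *m P *m x t) (x t).
    rewrite mulmxE -NH mulmxBl sformBl -!mulmxA N_sa !Nx sformDr mulmxDr.
    by rewrite sformDl -!scalemxAr !sformZr !sformZl c_real tau_real; ring.
  have -> : P = 1 - Q * N ^+ k.+1 by rewrite -QN opprB addrC subrK.
  rewrite -mulmxA N_sa mulmxBl mul1mx sformBl.
  rewrite -gE -!scalemxAr sformZl mulrBr mulrA divff // mul1r.
  rewrite [in B (x t) _]Nx sformDr !sformZr null_x mulr0 add0r tau_real.
  by rewrite -mulmxE -mulmxA.
have lim : B (H *m x0) b0 - B (H *m b0) x0 = B x0 b0.
  pose rhs t := B (x t) (b t) -
    B (Q *m (g k.+1 t *: x t + pow_remainder k.+1 t)) (N *m x t).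
  have rhs_lhs : rhs t @[t --> U] --> B (H *m x0) b0 - B (H *m b0) x0.
    under eq_cvg do rewrite /rhs -virial.
    apply: cvgB; apply: cvg_sform => //.
      exact: mx_cvgM (mx_cvg_cst H) x_cvg.
    exact: mx_cvgM (mx_cvg_cst H) b_cvg.
  apply: (@cvg_unique C (@norm_hausdorff C C) _ _ _ _ rhs_lhs).
  (* The term with [Q] disappears: its first argument converges, while [N *m x t] tends to
     [N *m x0 = 0]. *)
  rewrite /rhs /=.
  rewrite -[X in _ --> X]subr0 -(sform0r S (Q *m (l_K *: x0 + N ^+ k *m b0))) -Nx0.
  apply: cvgB; apply: cvg_sform => //.
    apply: mx_cvgM (mx_cvg_cst Q) _.
    exact: mx_cvgD (mx_cvgZ gK_cvg x_cvg) (@pow_remainder_cvg k).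
  exact: mx_cvgM (mx_cvg_cst N) x_cvg.
(* Comparing the two values gives [(p + 1) * B x0 b0 = 0], and [p + 1] is nonzero in characteristic
   zero. *)
have := grading_virial cPN NH Nx0 Px0 x0E b0E r_real.
rewrite lim => /eqP; rewrite mulNr -addr_eq0 -{1}(mul1r (B x0 b0)) -mulrDl.
rewrite mulf_eq0 addrC natr1 pnatr_eq0 /= => /eqP Bx0b0.
by rewrite B_herm Bx0b0 rmorph0.
Qed.

End SelfAdjointLimit.

(** * Null eigenvectors of isometries *)

Section IndefiniteEigenspace.
Variables (C : numClosedFieldType) (n : nat) (S M : 'M[C]_n.+1).
Local Notation B := (sform S).
Hypothesis B_herm : forall x y, B y x = (B x y)^*.

Lemma indefinite_null_vector (x y : 'cV[C]_n.+1) :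
  0 < B x x -> B y y < 0 -> exists s : C, x + s *: y != 0 /\
    B (x + s *: y) (x + s *: y) = 0.
Proof.
move=> x_pos y_neg; set h := B x y.
(* The phase [u] makes [u^* * h] purely imaginary, which removes the cross terms; only
   [B x x + rho ^+ 2 * B y y] remains, and [rho] is chosen to cancel it. *)
have [u [uu hu]] : exists u : C, u * u^* = 1 /\ u^* * h + u * h^* = 0.
  have [->|h0] := eqVneq h 0; first by exists 1; rewrite !rmorph1 rmorph0; split; ring.
  have nh0 : `|h| != 0 by rewrite normr_eq0.
  have hh : h * h^* = `|h| ^+ 2 by rewrite normCK.
  exists ('i * h / `|h|); rewrite !(rmorphM, fmorphV) /= conjCi conj_normC; split.
    rewrite [X in X = _](_ : _ = - ('i ^+ 2) * (h * h^*) / `|h| ^+ 2).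
      by rewrite sqrCi opprK mul1r hh divff // expf_neq0.
    by field; exact: nh0.
  by ring.
pose rho := sqrtC (- B x x / B y y).
have rho2 : rho ^+ 2 = - B x x / B y y by rewrite sqrtCK.
have rho_ge0 : 0 <= rho.
  by rewrite sqrtC_ge0 mulNr -mulrN -invrN mulr_ge0 ?invr_ge0 ?oppr_ge0 ?ltW.
have rho_conj : rho^* = rho by apply/CrealP/ger0_real.
have By0 : B y y != 0 by rewrite lt_eqF.
exists (rho * u); split.
  apply: contraTneq x_pos => /eqP; rewrite addr_eq0 => /eqP ->.
  rewrite -scaleNr sformZl sformZr mulrA -normCK le_gtF //.
  by rewrite mulr_ge0_le0 ?exprn_ge0 // ltW.
rewrite !(sformDl, sformDr) !(sformZl, sformZr) -/h (B_herm x y) -/h rmorphM /=.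
rewrite rho_conj.
rewrite [LHS](_ : _ = B x x + rho * (u^* * h + u * h^*)
  + rho ^+ 2 * (u * u^*) * B y y); last by ring.
by rewrite hu uu rho2 mulr0 addr0 mulr1 divfK // subrr.
Qed.

Hypothesis M_isom : forall x y, B (M *m x) (M *m y) = B x y.

(** Isometry gives [B w u = lambda^* * B (M *m w) u]. After multiplication by [lambda], the two
    terms of [B u u] cancel. *)
Lemma jordan_chain_null (lambda : C) (w : 'cV[C]_n.+1) :
    let u := (lambda%:M - M) *m w in
  lambda * lambda^* = 1 -> M *m u = lambda *: u -> B u u = 0.
Proof.
move=> u ll Mu; have Bwu : B w u = lambda^* * B (M *m w) u.
  by rewrite -M_isom Mu sformZr.
by rewrite {1}/u mulmxBl sformBl mul_scalar_mx sformZl Bwu mulrA ll mul1r subrr.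
Qed.

(** Either some Jordan chain has length at least two, and its final eigenvector is null, or all
    generalized eigenvectors are eigenvectors and a combination of [x] and [y] is null. *)
Lemma null_eigenvector (lambda : C) k (x y : 'cV[C]_n.+1) :
    lambda * lambda^* = 1 ->
    (lambda%:M - M) ^+ k *m x = 0 -> (lambda%:M - M) ^+ k *m y = 0 ->
    0 < B x x -> B y y < 0 ->
  exists v, [/\ v != 0, M *m v = lambda *: v & B v v = 0].
Proof.
move=> ll; set D := lambda%:M - M => Dx Dy x_pos y_neg.
have Dker (v : 'cV[C]_n.+1) : D *m v = 0 -> M *m v = lambda *: v.
  by rewrite /D mulmxBl mul_scalar_mx => /eqP; rewrite subr_eq0 => /eqP.
have [[v [Dkv Dv]]|noD] := EM (exists v : 'cV[C]_n.+1, D ^+ k *m v = 0 /\ D *m v != 0).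
  have ex_j : exists j, D ^+ j *m v == 0 by exists k; apply/eqP.
  have [[|[|j]] /eqP Djv j_min] := ex_minnP ex_j.
  - by rewrite expr0 mul1mx in Djv; rewrite Djv mulmx0 eqxx in Dv.
  - by rewrite expr1 in Djv; rewrite Djv eqxx in Dv.
  have DjS i : D ^+ i.+1 *m v = D *m (D ^+ i *m v) by rewrite exprS -mulmxE mulmxA.
  have Mu : M *m (D *m (D ^+ j *m v)) = lambda *: (D *m (D ^+ j *m v)).
    by apply: Dker; rewrite -!DjS.
  exists (D *m (D ^+ j *m v)); split => //; last exact: jordan_chain_null.
  by rewrite -DjS; apply/negP => /j_min; rewrite ltnn.
have Dker0 (v : 'cV[C]_n.+1) : D ^+ k *m v = 0 -> D *m v = 0.
  move=> Dkv; apply/eqP/negPn/negP => Dv; by apply: noD; exists v.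
have [s [v0 Bv]] := indefinite_null_vector x_pos y_neg.
exists (x + s *: y); split => //; apply: Dker; apply: Dker0.
by rewrite mulmxDr Dx -scalemxAr Dy scaler0 addr0.
Qed.

End IndefiniteEigenspace.

(** Scaling by the sum of the moduli bounds each entry by 1. The normalized sum stays equal to 1 in
    the limit, so [x0] is nonzero. *)
Lemma ultra_normalized_cvg (C : numClosedFieldType) (T : Type)
    (U : set_system T) {UU : UltraFilter U} (n : nat) (x : T -> 'cV[C]_n) :
    bounded_cvg C U -> (forall t, x t != 0) ->
  exists (a : T -> C) (x0 : 'cV[C]_n),
    [/\ forall t, a t != 0, x0 != 0 & mx_cvg U (fun t => a t *: x t) x0].
Proof.
move=> bU x_neq0; pose UP : ProperFilter U := ultra_proper.
pose N t := \sum_j `|x t j 0|.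
have N_ge j t : `|x t j 0| <= N t.
  by rewrite /N (bigD1 j) //= lerDl sumr_ge0.
have N0 t : N t != 0.
  apply: contra (x_neq0 t) => /eqP N0; apply/eqP/colP => j; rewrite mxE.
  by apply/eqP; rewrite -normr_eq0 eq_le normr_ge0 -N0 N_ge.
have N_pos t : 0 < N t by rewrite lt_def N0 sumr_ge0.
have x_le j t : `|(N t)^-1 * x t j 0| <= 1.
  by rewrite normrM normfV (gtr0_norm (N_pos t)) mulrC ler_pdivrMr ?mul1r.
have /choice[l lE] j : exists l : C, (N t)^-1 * x t j 0 @[t --> U] --> l.
  by apply: (bU _ 1); apply: filterE => t; apply: x_le.
exists (fun t => (N t)^-1), (\col_j l j); split => [t||i j].
- by rewrite invr_eq0.
- have lim : \sum_j `|(N t)^-1 * x t j 0| @[t --> U] --> \sum_j `|l j|.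
    apply: cvg_big => [|j _]; first exact: add_continuous.
    exact: cvg_norm (lE j).
  have lim1 : \sum_j `|(N t)^-1 * x t j 0| @[t --> U] --> (1 : C).
    under eq_cvg => t.
      under eq_bigr do rewrite normrM normfV (gtr0_norm (N_pos t)).
      rewrite -mulr_sumr mulVf //.
      over.
    exact: cvg_cst.
  have : \sum_j `|l j| = 1.
    exact: (@cvg_unique C (@norm_hausdorff C C) _ _ _ _ lim lim1).
  apply: contra_eq_neq => l0; rewrite big1 1?eq_sym ?oner_neq0 // => j _.
  by have := congr1 (fun M : 'cV_n => M j 0) l0; rewrite !mxE => ->; rewrite normr0.
- by rewrite mxE ord1; under eq_cvg do rewrite mxE; apply: lE.
Qed.

(** * Limits of null eigenvectors in a differentiable family *)

Section UnitaryNullLimit.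
Variables (C : numClosedFieldType) (n : nat) (S : 'M[C]_n.+1).
Local Notation B := (sform S).
Hypothesis B_herm : forall x y, B y x = (B x y)^*.
Variables (T : Type) (U : set_system T).
Context {UU : UltraFilter U}.
Hypothesis bU : bounded_cvg C U.
Variables (M M' : T -> 'M[C]_n.+1) (M0 M0' dM dM' : 'M[C]_n.+1).
Hypothesis M'M : forall t, M' t *m M t = 1%:M.
Hypothesis M0_adj : forall x y, B (M0 *m x) y = B x (M0' *m y).
Variable tau : T -> C.
Hypotheses (tau_real : forall t, (tau t)^* = tau t) (tau_neq0 : forall t, tau t != 0).
Hypothesis tau_cvg : tau t @[t --> U] --> (0 : C).
Hypothesis dM_cvg : mx_cvg U (fun t => (tau t)^-1 *: (M t - M0)) dM.
Hypothesis dM'_cvg : mx_cvg U (fun t => (tau t)^-1 *: (M' t - M0')) dM'.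

Let UP : ProperFilter U := ultra_proper.

(* The isometry is replaced by the self-adjoint [i (l0^* M0 - l0 M0^-1)], whose
   kernel contains the eigenvectors of [M0] for [l0]. *)
Lemma isometry_null_limit (lambda : T -> C) (x : T -> 'cV[C]_n.+1) :
    (forall t, `|lambda t| = 1) -> (forall t, x t != 0) ->
    (forall t, M t *m x t = lambda t *: x t) -> (forall t, B (x t) (x t) = 0) ->
  exists l0 x0, [/\ `|l0| = 1, x0 != 0, M0 *m x0 = l0 *: x0 &
    B (l0^* *: (dM *m x0) - l0 *: (dM' *m x0)) x0 = 0].
Proof.
move=> norm_l x_neq0 Mx null_x.
have [l0 l_cvg] : exists l0 : C, lambda t @[t --> U] --> l0.
  by apply: (bU (M := 1)); apply: filterE => t /=; rewrite norm_l.
have [a [x0 [a_neq0 x0_neq0 y_cvg]]] := ultra_normalized_cvg bU x_neq0.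
pose y t := a t *: x t.
have {}Mx t : M t *m y t = lambda t *: y t.
  by rewrite -scalemxAr Mx !scalerA mulrC.
have {}null_x t : B (y t) (y t) = 0 by rewrite sformZl sformZr null_x !mulr0.
have norm_l0 : `|l0| = 1.
  have lim1 : `|lambda t| @[t --> U] --> (1 : C).
    by under eq_cvg do rewrite norm_l; apply: cvg_cst.
  exact: (@cvg_unique C (@norm_hausdorff C C) _ _ _ _ (cvg_norm l_cvg) lim1).
have unit_conj (l : C) : `|l| = 1 -> l * l^* = 1.
  by move=> l1; rewrite -normCK l1 expr1n.
have M'x t : M' t *m y t = (lambda t)^* *: y t.
  rewrite -[y t in LHS]scale1r -(unit_conj _ (norm_l t)) mulrC -scalerA -Mx.
  by rewrite -scalemxAr mulmxA M'M mul1mx.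
have M_cvg : mx_cvg U M M0.
  rewrite -[M0 in X in mx_cvg _ _ X](addr0 M0) -(scale0r dM) => i j.
  under eq_cvg => t.
    have -> : M t i j = (M0 + tau t *: ((tau t)^-1 *: (M t - M0))) i j.
      by rewrite scalerA divff // scale1r addrC subrK.
    over.
  exact: mx_cvgD (mx_cvg_cst M0) (mx_cvgZ tau_cvg dM_cvg) i j.
have M0x0 : M0 *m x0 = l0 *: x0.
  apply: (mx_cvg_unique (mx_cvgM M_cvg y_cvg)) => i j.
  by under eq_cvg do rewrite Mx; apply: mx_cvgZ l_cvg y_cvg i j.
exists l0, x0; split => //.
pose N := 'i *: (l0^* *: M0 - l0 *: M0').
pose c t := 'i * (l0^* * lambda t - l0 * (lambda t)^*).
pose b t := - 'i *: (l0^* *: ((tau t)^-1 *: (M t - M0)) *m y t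
                   - l0 *: ((tau t)^-1 *: (M' t - M0')) *m y t).
pose b0 := - 'i *: (l0^* *: dM *m x0 - l0 *: dM' *m x0).
suff : B b0 x0 = 0.
  rewrite /b0 sformZl -!scalemxAl => /eqP.
  by rewrite mulf_eq0 oppr_eq0 (negbTE (neq0Ci C)) /= => /eqP.
apply: (@selfadjoint_null_limit _ _ S N _ _ U _ bU B_herm y b x0 b0 c tau) => //.
- move=> u v; have M0'_adj : B (M0' *m u) v = B u (M0 *m v).
    by rewrite B_herm -M0_adj -B_herm.
  rewrite /N -!scalemxAl !(mulmxBl, sformZl, sformZr) -!scalemxAl.
  rewrite !(sformBl, sformBr, sformZl, sformZr) M0_adj M0'_adj conjCi conjCK.
  by ring.
- move=> t; rewrite /N /c /b.
  have dqE (K K0 : 'M[C]_n.+1) : K0 *m y t = K *m y t - tau t *: ((tau t)^-1 *: (K - K0) *m y t).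
    by rewrite -scalemxAl scalerA divff // scale1r mulmxBl opprB addrC subrK.
  rewrite -!scalemxAl mulmxBl -!scalemxAl (dqE (M t) M0) (dqE (M' t) M0') Mx M'x.
  rewrite -!scalemxAl; set u := (M t - M0) *m y t; set v := (M' t - M0') *m y t.
  move: (y t) u v => z u v.
  by apply/colP => i; rewrite !mxE; ring.
- by move=> t; rewrite /c rmorphM rmorphB !rmorphM /= !conjCK conjCi; ring.
- apply: mx_cvgZ; first exact: cvg_cst.
  apply: mx_cvgB; apply: mx_cvgM => //; apply: mx_cvgZ => //; exact: cvg_cst.
- have -> : 0 = 'i * (l0^* * l0 - l0 * l0^*) :> C by rewrite mulrC; ring.
  apply: cvgM; first exact: cvg_cst.
  apply: cvgB; apply: cvgM; [exact: cvg_cst|by []|exact: cvg_cst|].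
  exact: cvg_conjC.
Qed.

End UnitaryNullLimit.

(** * The complex Krein form and the flow *)

Lemma ultra_fmap (T V : Type) (U : set_system T) (f : T -> V) :
  UltraFilter U -> UltraFilter (f @ U).
Proof.
move=> UU; have UP : ProperFilter U := @ultra_proper _ _ UU.
split=> [|G GP UG]; first exact: fmap_proper_filter.
apply/seteqP; split=> // A GA; have [//|UA] := in_ultra_setVsetC (f @^-1` A) UU.
have : G (A `&` ~` A) by apply: filterI => //; apply: UG.
by rewrite setICr => /filter_ex[].
Qed.

(** The image ultrafilter contains the compact segment from [- M] to [M], so it converges. *)
Lemma bounded_cvg_real (R : realType) (T : Type) (U : set_system T) :
  UltraFilter U -> bounded_cvg R U.
Proof.
move=> UU f M fM; have := @segment_compact R (- M) M; rewrite compact_ultra.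
have UP : ProperFilter U := @ultra_proper _ _ UU.
move=> /(_ _ (ultra_fmap f UU)); case.
  by apply: (@filterS T U _ _ _ _ fM) => t /=; rewrite in_itv /= -ler_norml.
by move=> l [_ fl]; exists l.
Qed.

Lemma complex_cvg_Re_Im (R : realType) (T : Type) (F : set_system T)
    (C := R[i] : numClosedFieldType) (f : T -> C) (a b : R) :
    Filter F ->
    complex.Re (f t) @[t --> F] --> a -> complex.Im (f t) @[t --> F] --> b ->
  f t @[t --> F] --> (complex.Complex a b : C).
Proof.
move=> FF /cvgrPdist_lt fa /cvgrPdist_lt fb; apply/cvgrPdist_lt => e.
(* The radius [e] is complex; its positivity forces its imaginary part to be 0. *)
case: e => e e'; rewrite ltcE /= => /andP[/eqP -> e0].
have e2 : 0 < e / 2 by rewrite divr_gt0.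
apply: filterS (filterI (fa _ e2) (fb _ e2)) => t [].
case: (f t) => u v /= ua vb.
have -> : complex.Complex a b - complex.Complex u v =
   real_complex R (a - u) + 'i%C * real_complex R (b - v).
  by apply/eqP; rewrite eq_complex /= !mul0r !mul1r !(subr0, addr0, add0r) !eqxx.
apply: le_lt_trans (ler_normD _ _) _.
have nR (x : R) : `|real_complex R x| = real_complex R `|x|.
  by rewrite normc_def /= expr0n addr0 sqrtr_sqr.
have -> : `|'i%C * real_complex R (b - v)| = `|real_complex R (b - v)|.
  by rewrite normrM [X in X * _](_ : _ = 1) ?mul1r // normc_def /= expr0n expr1n add0r sqrtr1.
rewrite !nR -rmorphD ltcE /= eqxx /= [ltRHS](splitr e).
exact: ltrD.
Qed.

Lemma real_complex_cvg (R : realType) (T : Type) (F : set_system T)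
    (C := R[i] : numClosedFieldType) (f : T -> R) (a : R) :
    Filter F -> f t @[t --> F] --> a ->
  (real_complex R (f t) : C) @[t --> F] --> (real_complex R a : C).
Proof.
by move=> FF fa; apply: complex_cvg_Re_Im => //; apply: cvg_cst.
Qed.

Lemma bounded_cvg_complex (R : realType) (T : Type) (U : set_system T)
    (C := R[i] : numClosedFieldType) :
  UltraFilter U -> bounded_cvg C U.
Proof.
move=> UU f M fM; have UP : ProperFilter U := @ultra_proper _ _ UU.
have bound t : `|f t| <= M -> `|complex.Re (f t)| <= complex.Re M /\
    `|complex.Im (f t)| <= complex.Re M.
  rewrite normc_def lecE /= => /andP[_ le_M]; split; apply: le_trans le_M.
    by rewrite -sqrtr_sqr ler_wsqrtr // lerDl sqr_ge0.
  by rewrite -sqrtr_sqr ler_wsqrtr // lerDr sqr_ge0.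
have [a fa] : exists a : R, complex.Re (f t) @[t --> U] --> a.
  by apply: (bounded_cvg_real UU (M := complex.Re M)); apply: filterS fM => t /bound[].
have [b fb] : exists b : R, complex.Im (f t) @[t --> U] --> b.
  by apply: (bounded_cvg_real UU (M := complex.Re M)); apply: filterS fM => t /bound[].
by exists (complex.Complex a b); apply: complex_cvg_Re_Im.
Qed.

(** * Derivatives of matrix-valued functions *)

Section MatrixDerivative.
Variable R : realType.

Lemma is_derive_mxP (m n : nat) (f : R -> 'M[R]_(m, n)) (t : R) (D : 'M[R]_(m, n)) :
  is_derive t (1 : R) f D <->
  forall i j, is_derive t (1 : R) (fun s => f s i j) (D i j).
Proof.
split=> [fD i j|fD].
  have fd : derivable f t 1 by exact: ex_derive.
  apply: DeriveDef; first by move/derivable_mxP: fd.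
  by rewrite -(@derive_val _ _ _ _ _ _ _ fD) derive_mx // mxE.
have fd : derivable f t 1 by apply/derivable_mxP => i j; exact: ex_derive.
apply: DeriveDef => //; apply/matrixP => i j.
by rewrite derive_mx // mxE; exact: derive_val.
Qed.

Lemma is_derive_mulmx (m n p : nat) (f : R -> 'M[R]_(m, n)) (g : R -> 'M[R]_(n, p))
    (t : R) Df Dg :
    is_derive t (1 : R) f Df -> is_derive t (1 : R) g Dg ->
  is_derive t (1 : R) (fun s => f s *m g s) (Df *m g t + f t *m Dg).
Proof.
move=> /is_derive_mxP fD /is_derive_mxP gD; apply/is_derive_mxP => i j.
pose h k s := f s i k * g s k j.
have -> : (fun s => (f s *m g s) i j) = \sum_k h k.
  by apply/funext => s; rewrite mxE fct_sumE.
have -> : (Df *m g t + f t *m Dg) i j = \sum_k (f t i k *: Dg k j + g t k j *: Df i k).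
  rewrite !mxE -big_split; apply: eq_bigr => k _ /=.
  by rewrite addrC [Df i k * _]mulrC.
apply: is_derive_sum => k; exact: is_deriveM (fD i k) (gD k j).
Qed.

Lemma is_derive_trmx (m n : nat) (f : R -> 'M[R]_(m, n)) (t : R) Df :
  is_derive t (1 : R) f Df -> is_derive t (1 : R) (fun s => (f s)^T) Df^T.
Proof.
move=> /is_derive_mxP fD; apply/is_derive_mxP => i j; rewrite mxE.
by have -> : (fun s => (f s)^T i j) = fun s => f s j i by apply/funext => s; rewrite mxE.
Qed.

Lemma is_derive_mx0_cst (m n : nat) (f : R -> 'M[R]_(m, n)) :
  (forall t, is_derive t (1 : R) f 0) -> forall s t, f s = f t.
Proof.
move=> f0 s t; apply/matrixP => i j.
apply: (@is_derive_0_is_cst R (fun u => f u i j)) => u.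
by have /is_derive_mxP/(_ i j) := f0 u; rewrite mxE.
Qed.

(** Since [s k] avoids [t0], the increments tend to 0 in the punctured neighbourhood filter, where
    the derivative is defined. *)
Lemma derive_quotient_cvg (f : R -> R) (t0 Df : R) (T : Type) (F : set_system T)
    (s : T -> R) :
    Filter F -> is_derive t0 (1 : R) f Df -> (forall k, s k != t0) ->
    s k @[k --> F] --> t0 ->
  (s k - t0)^-1 * (f (s k) - f t0) @[k --> F] --> Df.
Proof.
move=> FF fD st0 s_cvg.
have quot : h^-1 *: (f (h *: 1 + t0) - f t0) @[h --> 0^'] --> Df.
  rewrite -(@derive_val _ _ _ _ _ _ _ fD).
  exact: (@ex_derive _ _ _ _ _ _ _ fD).
have s0 : s k - t0 @[k --> F] --> 0^'.
  have s0 : s k - t0 @[k --> F] --> (0 : R).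
    by rewrite -(subrr t0); apply: cvgB => //; apply: cvg_cst.
  move=> V /s0 FV; apply: (@filterS T F _ _ _ _ FV) => k /= Vk.
  by apply: Vk; rewrite subr_eq0.
have := cvg_comp _ _ s0 quot; apply: cvg_trans; apply: near_eq_cvg.
by apply: nearW => k /=; rewrite /GRing.scale /= mulr1 subrK.
Qed.

End MatrixDerivative.

(** * The symplectic form and its invariance under the flow *)

Section SymplecticForm.
Variable n : nat.

Lemma trmx_Jmx (K : pzRingType) : (Jmx K n)^T = - Jmx K n.
Proof.
by rewrite /Jmx tr_block_mx opp_block_mx raddfN /= !trmx0 !trmx1 oppr0 opprK.
Qed.

Lemma mul_Jmx (K : pzRingType) : Jmx K n *m Jmx K n = - 1%:M.
Proof.
rewrite /Jmx mulmx_block !mul0mx !mulmx0 mul1mx mulmx1 !(add0r, addr0).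
by rewrite [in RHS]scalar_mx_block opp_block_mx oppr0.
Qed.

Lemma map_Jmx (K L : pzRingType) (f : {rmorphism K -> L}) :
  map_mx f (Jmx K n) = Jmx L n.
Proof. by rewrite /Jmx map_block_mx map_mxN map_mx1 !map_mx0. Qed.

(** The derivative of [gamma^T J gamma] is [gamma^T A gamma - gamma^T A gamma = 0], by symmetry of
    [A], [J^T = - J] and [J^2 = - 1]. *)
Lemma symplectic_flow (R : realType) (A gamma : R -> 'M[R]_(n + n)) :
    (forall t, (A t)^T = A t) ->
    (forall t : R, is_derive t (1 : R) gamma (Jmx R n *m A t *m gamma t)) ->
  symplectic (gamma 0) -> forall t, symplectic (gamma t).
Proof.
move=> A_sym ode init t; rewrite /symplectic -[RHS]init.
apply: (is_derive_mx0_cst (f := fun t => (gamma t)^T *m Jmx R n *m gamma t)).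
move=> u; have cJ : is_derive u (1 : R) (fun=> Jmx R n) 0 by exact: is_derive_cst.
have := is_derive_mulmx (is_derive_mulmx (is_derive_trmx (ode u)) cJ) (ode u).
congr is_derive; rewrite mulmx0 addr0.
have -> : (Jmx R n *m A u *m gamma u)^T *m Jmx R n = (gamma u)^T *m A u.
  rewrite !trmx_mul A_sym trmx_Jmx -!mulmxA mulNmx mul_Jmx opprK.
  by rewrite mulmx1.
have -> : (gamma u)^T *m Jmx R n *m (Jmx R n *m A u *m gamma u) =
    - ((gamma u)^T *m A u *m gamma u).
  rewrite -!mulmxA [Jmx R n *m (Jmx R n *m _)]mulmxA mul_Jmx mulNmx mul1mx.
  by rewrite mulmxN.
by rewrite subrr.
Qed.

End SymplecticForm.

Lemma not_isolated_seq (R : realType) (D : set R) (t0 : R) :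
    D t0 -> ~ isolated D t0 ->
  exists s : nat -> R, [/\ forall k, D (s k), forall k, s k != t0 &
    s k @[k --> \oo] --> t0].
Proof.
move=> Dt0 niso.
have /choice[s sP] k : exists t : R, [/\ D t, t != t0 & `|t0 - t| < k.+1%:R^-1].
  apply: contrapT => no_t; apply: niso; split; first exact/mem_set.
  exists (ball t0 (k.+1%:R^-1)); first by apply: nbhsx_ballx; rewrite invr_gt0.
  apply/seteqP; split=> [t [bt Dt]|_ ->]; last first.
    by split=> //; apply: ballxx; rewrite invr_gt0.
  by apply: contrapT => /eqP tt0; apply: no_t; exists t.
exists s; split=> [k|k|]; [by have [] := sP k | by have [] := sP k |].
apply/cvgrPdist_lt => e e0; near=> k.
have [_ _ /lt_trans] := sP k; apply.
by near: k; exact: near_infty_natSinv_lt (PosNum e0).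
Unshelve. all: by end_near. Qed.

(** * The Krein form as a Hermitian form *)

Section KreinForm.
Variables (R : realType) (n : nat).
Local Notation CM := (@complexify R (n + n)).

Definition krein_mx : 'M[R[i]]_(n + n) := 'i *: Jmx R[i] n.

Lemma cdotE (m : nat) (x y : 'cV[R[i]]_m) :
  cdot x y = (x^T *m map_mx Num.conj y) 0 0.
Proof. by rewrite mxE; apply: eq_bigr => j _; rewrite !mxE. Qed.

Lemma kreinE (x y : 'cV[R[i]]_(n + n)) : krein x y = sform krein_mx x y.
Proof.
rewrite /krein cdotE map_mxM map_Jmx /sform /krein_mx -scalemxAr -scalemxAl.
by rewrite mulmxA [RHS]mxE.
Qed.

Lemma conj_complexify (m : nat) (M : 'M[R]_m) :
  map_mx Num.conj (complexify M) = complexify M.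
Proof. by apply/matrixP => i j; rewrite !mxE; exact: conjc_real. Qed.

Lemma krein_herm (x y : 'cV[R[i]]_(n + n)) :
  sform krein_mx y x = (sform krein_mx x y)^*.
Proof.
have conjS : map_mx Num.conj krein_mx = krein_mx^T.
  by rewrite /krein_mx map_mxZ map_Jmx linearZ /= trmx_Jmx conjCi scaleNr scalerN.
have conjK (z : 'cV[R[i]]_(n + n)) : map_mx Num.conj (map_mx Num.conj z) = z.
  by apply/matrixP => i j; rewrite !mxE conjCK.
have -> : sform krein_mx y x = (y^T *m krein_mx *m map_mx Num.conj x)^T 0 0.
  by rewrite mxE.
transitivity (map_mx Num.conj (x^T *m krein_mx *m map_mx Num.conj y) 0 0).
  by rewrite !map_mxM conjS conjK !trmx_mul trmxK map_trmx mulmxA.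
by rewrite mxE.
Qed.

Lemma complexifyM (M M1 : 'M[R]_(n + n)) : CM (M *m M1) = CM M *m CM M1.
Proof. exact: map_mxM. Qed.

(** The adjoint is written [- J M^T J], which makes sense for every real matrix, is linear in [M],
    and is the inverse when [M] is symplectic. *)
Lemma krein_adjoint (M : 'M[R]_(n + n)) x y :
  sform krein_mx (CM M *m x) y =
  sform krein_mx x (CM (- (Jmx R n *m M^T *m Jmx R n)) *m y).
Proof.
rewrite /sform map_mxM conj_complexify trmx_mul !mulmxA; congr ((_ *m _) 0 0).
rewrite -!mulmxA; congr (_ *m _); rewrite /krein_mx -!scalemxAr -!scalemxAl.
congr (_ *: _).
rewrite /complexify map_mxN !map_mxM map_Jmx mulmxN !mulmxA mul_Jmx.
by rewrite !mulNmx opprK mul1mx map_trmx.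
Qed.

(** This turns the Krein product with [J A x0] into the quantity that [A_pos] makes positive. *)
Lemma krein_J (u x : 'cV[R[i]]_(n + n)) :
  sform krein_mx (Jmx R[i] n *m u) x = 'i * cdot u x.
Proof.
rewrite /sform /krein_mx trmx_mul trmx_Jmx -scalemxAr -scalemxAl mxE cdotE.
by rewrite -!mulmxA [(- _) *m _]mulNmx mulmxA mul_Jmx mulNmx opprK mul1mx.
Qed.

Lemma symplectic_inv (M : 'M[R]_(n + n)) : symplectic M ->
  - (Jmx R n *m M^T *m Jmx R n) *m M = 1%:M.
Proof.
by move=> sM; rewrite mulNmx -!mulmxA (mulmxA M^T) sM mul_Jmx opprK.
Qed.

End KreinForm.

(* Dimensions are written as successors to match the matrix ring structures. *)
Lemma krein_indefinite_null_eigenvector (R : realType) (n : nat)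
    (M : 'M[R]_(n.+1 + n.+1)) (lambda : R[i]) :
    symplectic M -> krein_indefinite_eigenvalue M lambda ->
  exists v : 'cV[R[i]]_(n.+1 + n.+1), [/\ `|lambda| = 1, v != 0,
    complexify M *m v = lambda *: v & sform (krein_mx R n.+1) v v = 0].
Proof.
move=> sM [_ norm_l [[x Ex x_pos] [y Ey y_neg]]].
have M_isom u v : sform (krein_mx R n.+1) (complexify M *m u) (complexify M *m v) =
    sform (krein_mx R n.+1) u v.
  by rewrite krein_adjoint mulmxA -complexifyM symplectic_inv // /complexify
    map_mx1 mul1mx.
rewrite !kreinE in x_pos y_neg.
have ll : lambda * lambda^* = 1 by rewrite -normCK norm_l expr1n.
have [v [v0 Mv Bv]] := @null_eigenvector R[i] (n + n.+1)%N _ _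
  (@krein_herm R n.+1) M_isom lambda _ x y ll Ex Ey x_pos y_neg.
by exists v.
Qed.

Lemma complexify_quotient_cvg (R : realType) (C := R[i] : numClosedFieldType)
    (m : nat) (f : R -> 'M[R]_m) (t0 : R) (Df : 'M[R]_m) (T : Type)
    (F : set_system T) (s : T -> R) :
    Filter F -> is_derive t0 (1 : R) f Df -> (forall k, s k != t0) ->
    s k @[k --> F] --> t0 ->
  @mx_cvg C T F m m (fun k => (real_complex R (s k - t0))^-1 *:
    (complexify (f (s k)) - complexify (f t0))) (complexify Df).
Proof.
move=> FF /is_derive_mxP fD st0 s_cvg i j.
have lim := derive_quotient_cvg FF (fD i j) st0 s_cvg.
rewrite mxE; apply: cvg_trans (real_complex_cvg FF lim).
apply: near_eq_cvg; apply: nearW => k.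
by rewrite !mxE rmorphM fmorphV !rmorphB.
Qed.

Theorem theorem1p1 (R : realType) (n : nat) (A gamma : R -> 'M[R]_(n + n))
    (n_ge1 : (1 <= n)%N)
    (A_cont : continuous A)
    (A_sym : forall t : R, (A t)^T = A t)
    (gamma_ode : forall t : R,
      is_derive t (1 : R) gamma (Jmx R n *m A t *m gamma t))
    (gamma_init : symplectic (gamma 0))
    (A_pos : forall (t : R) (omega : R[i]), unit_circle omega ->
      forall x : 'cV[R[i]]_(n + n),
        cker (omega%:M - complexify (gamma t)) x -> x != 0 ->
        0 < cdot (complexify (A t) *m x) x) :
  discrete_subset [set t : R | exists lambda : R[i],
    krein_indefinite_eigenvalue (gamma t) lambda].
Proof.
case: n A gamma n_ge1 A_cont A_sym gamma_ode gamma_init A_pos => [//|n].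
move=> A gamma _ _ A_sym ode init A_pos.
have gamma_symp := symplectic_flow A_sym ode init.
move=> t0 Dt0; apply: contrapT => niso.
have [s [Ds st0 s_cvg]] := not_isolated_seq Dt0 niso.
(* An ultrafilter finer than [\oo] makes every bounded sequence converge, so no subsequences are
   extracted. *)
have [U [UU oo_U]] := ultraFilterLemma eventually_filter.
have UP : ProperFilter U := @ultra_proper _ _ UU.
have {}s_cvg : s k @[k --> U] --> t0 by move=> V /s_cvg /oo_U.
pose G k := complexify (gamma (s k)).
pose S := krein_mx R n.+1.
have /choice[p pP] k : exists p : R[i] * 'cV[R[i]]_(n.+1 + n.+1),
    [/\ `|p.1| = 1, p.2 != 0, G k *m p.2 = p.1 *: p.2 & sform S p.2 p.2 = 0].
  have [lambda /(krein_indefinite_null_eigenvector (gamma_symp _))[v]] := Ds k.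
  by exists (lambda, v).
(* On symplectic matrices this is the inverse; being linear in [M], it has derivative [inv DM] along
   the flow. *)
pose inv (M : 'M[R]_(n.+1 + n.+1)) := - (Jmx R n.+1 *m M^T *m Jmx R n.+1).
pose DM := Jmx R n.+1 *m A t0 *m gamma t0.
have inv_ode : is_derive t0 (1 : R) (fun t => inv (gamma t)) (inv DM).
  have cJ : is_derive t0 (1 : R) (fun=> Jmx R n.+1) 0 by exact: is_derive_cst.
  have := is_derive_mulmx (is_derive_mulmx cJ (is_derive_trmx (ode t0))) cJ.
  by rewrite mul0mx add0r mulmx0 addr0 => /is_deriveN.
pose C : numClosedFieldType := R[i].
pose tau k := real_complex R (s k - t0).
have tau_real k : (tau k)^* = tau k by exact: conjc_real.
have tau_neq0 k : tau k != 0 by rewrite fmorph_eq0 subr_eq0.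
have tau_cvg : (tau k : C) @[k --> U] --> (0 : C).
  rewrite -(rmorph0 (real_complex R)); apply: real_complex_cvg.
  by rewrite -(subrr t0); apply: cvgB => //; apply: cvg_cst.
have G_inv k : complexify (inv (gamma (s k))) *m G k = 1%:M.
  by rewrite -complexifyM symplectic_inv // /complexify map_mx1.
have [l0 [x0 [norm_l0 x0_neq0 Gx0]]] := @isometry_null_limit C (n + n.+1)%N S
  (@krein_herm R n.+1) nat U UU (bounded_cvg_complex UU) G _ _ _ _ _ G_inv
  (krein_adjoint (gamma t0)) tau tau_real tau_neq0 tau_cvg
  (complexify_quotient_cvg _ (ode t0) st0 s_cvg)
  (complexify_quotient_cvg _ inv_ode st0 s_cvg)
  (fun k => (p k).1) (fun k => (p k).2)
  (fun k => let: And4 a _ _ _ := pP k in a)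
  (fun k => let: And4 _ a _ _ := pP k in a)
  (fun k => let: And4 _ _ a _ := pP k in a)
  (fun k => let: And4 _ _ _ a := pP k in a).
pose u := Jmx R[i] n.+1 *m (complexify (A t0) *m x0).
have dG_x0 : complexify DM *m x0 = l0 *: u.
  by rewrite /DM !complexifyM -!mulmxA Gx0 -!scalemxAr /complexify map_Jmx.
have dinv_x0 : complexify (inv DM) *m x0 = - (complexify (inv (gamma t0)) *m u).
  have -> : inv DM = - (inv (gamma t0) *m (Jmx R n.+1 *m A t0)).
    rewrite /inv /DM !trmx_mul A_sym trmx_Jmx mulNmx opprK -!mulmxA.
    rewrite mulNmx mul_Jmx opprK mulmx1 [in RHS](mulmxA (Jmx R n.+1) _ (A t0)).
    by rewrite mul_Jmx mulNmx mul1mx !mulmxN.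
  rewrite [in LHS]/complexify map_mxN mulNmx map_mxM map_mxM map_Jmx.
  by rewrite -!mulmxA.
have adj_u : sform S (complexify (inv (gamma t0)) *m u) x0 = l0^* * sform S u x0.
  by rewrite krein_herm -krein_adjoint Gx0 -krein_herm sformZr.
have ll : l0 * l0^* = 1 by rewrite -normCK norm_l0 expr1n.
rewrite dG_x0 dinv_x0 scalerN opprK sformDl !sformZl adj_u.
(* The derivatives of [gamma] and of its inverse contribute equally, so the vanishing limit is twice
   [sform S u x0], that is [2 * 'i] times the product of [A x0] with [x0]. *)
rewrite [X in X = _](_ : _ = l0 * l0^* * sform S u x0 *+ 2); last by ring.
rewrite ll mul1r => /eqP; rewrite mulrn_eq0 /= krein_J.
rewrite mulf_eq0 (negbTE (neq0Ci _)) /= => /eqP cdot0.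
have ker_x0 : cker (l0%:M - complexify (gamma t0)) x0.
  by rewrite /cker /= mulmxBl mul_scalar_mx Gx0 subrr.
by have := A_pos t0 l0 norm_l0 x0 ker_x0 x0_neq0; rewrite cdot0 ltxx.
Qed.
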